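(* Let $A:X\to Y$ be an injective bounded linear operator between Banach spaces $X$ and $Y$ with range $\mathcal{R}(A)$ dense in $Y$. Let $\tilde{X}$ be a Banach space that is the direct sum $\tilde{X}=W+U$ (with $W\cap U=\{0\}$) of a closed subspace $W$, for which there exists a surjective bounded linear operator $C:W\to Y$, and a closed subspace $U$ isomorphic to $X$ with isomorphism $T:X\to U$. Then there exists a surjective bounded linear operator $B:\tilde{X}\to Y$ such that $A=B\,T$ and $U$ is a quasi-complement of the null-space $\mathcal{N}(B)$ in $\tilde{X}$.
   Context: $\mathcal{N}(B)$ denotes the null-space (kernel) of $B$ and $\mathcal{R}(A)$ the range of $A$. An isomorphism of Banach spaces is a bijective bounded linear operator with bounded inverse. A quasi-complement of a closed subspace $V$ of a Banach space $\tilde{X}$ is a closed subspace $U\subseteq\tilde{X}$ such that $U\cap V=\{0\}$ and $U+V$ is dense in $\tilde{X}$. *)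

(* Defs.v *)
From HB Require Import structures.
From mathcomp Require Import all_boot all_order all_algebra.
From mathcomp Require Import all_classical all_reals all_analysis.
From mathcomp Require Import complex.

Set Implicit Arguments.
Unset Strict Implicit.
Unset Printing Implicit Defensive.

Import GRing.Theory Num.Theory.
Import numFieldNormedType.Exports.

Local Open Scope classical_set_scope.
Local Open Scope ring_scope.

(* The scalar field K, with its order and norm, is R or the complex numbers
   over R, so that [completeNormedModType K] is the type of Banach spaces in
   the usual sense: with an arbitrary [numFieldType] K it would also cover,
   e.g., non-archimedean ordered fields, where Baire's theorem fails. *)
Definition real_or_complex (R : realType) (K : numFieldType) : Prop :=
  K = (R : numFieldType) \/ K = (complex R : numFieldType).

Section Operators.
Context {K : numFieldType}.

(* An operator defined on a subspace D of V only is represented by a function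
   on V of which only the values on D matter. *)
Definition linear_on (V W : normedModType K) (D : set V) (f : V -> W) : Prop :=
  forall (a : K) (u v : V), D u -> D v -> f (a *: u + v) = a *: f u + f v.

Definition op_bounded_on (V W : normedModType K) (D : set V) (f : V -> W) :
    Prop :=
  exists M : K, forall x, D x -> `|f x| <= M * `|x|.

Definition op_bounded (V W : normedModType K) (f : V -> W) : Prop :=
  op_bounded_on setT f.

Definition closed_subspace (V : normedModType K) (D : set V) : Prop :=
  closed D /\ submod_closed (mem D).

(* The inverse S of T : V -> D is given by its values on D. *)
Definition isomorphism_onto (V W : normedModType K) (D : set W)
    (T : {linear V -> W}) : Prop :=
  [/\ op_bounded T, set_bij setT D T &
      exists S : W -> V, cancel T S /\ op_bounded_on D S].

Definition subspace_sum (V : normedModType K) (D E : set V) : set V :=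
  [set x + y | x in D & y in E].

Definition direct_sum (V : normedModType K) (D E : set V) : Prop :=
  D `&` E = [set 0] /\ subspace_sum D E = setT.

Definition null_space (V W : normedModType K) (f : V -> W) : set V :=
  f @^-1` [set 0].

Definition quasi_complement (V : normedModType K) (D E : set V) : Prop :=
  [/\ closed_subspace D, closed_subspace E,
      E `&` D = [set 0] & dense (subspace_sum E D)].

End Operators.

(* Main.v *)
Require Import Defs.
From HB Require Import structures.
From mathcomp Require Import all_boot all_order all_algebra.
From mathcomp Require Import all_classical all_reals all_analysis.
From mathcomp Require Import complex ring.
Import Order.TTheory GRing.Theory Num.Theory.
Import numFieldNormedType.Exports.
Local Open Scope classical_set_scope.
Local Open Scope ring_scope.

(** Every x in Xt is w + T a with unique w in W and a in X, and B x := C w + A a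
    is the only linear extension of C from W that satisfies B T = A.  It is
    surjective because C already is, and U meets its null space trivially
    because A is injective.  Two facts need completeness.

    Boundedness of B requires the projections of the algebraic direct sum W + U
    to be bounded ([direct_sum_bounded]).  Density of N(B) + U follows from the
    density of B(U) = R(A) and the openness of B ([open_mapping]): given x, pick
    u in U with B u close to B x, then a small z with B z = B u - B x; the vector
    x + z is close to x, and x + z - u lies in N(B)
    ([quasi_complement_null_space]).

    Both facts follow from a single principle: a set which absorbs the space and
    is stable under half differences and under the infinite convex combinations
    of weights 1/2, 1/4, 1/8, ... contains a ball around 0
    ([superconvex_absorbing_ball]).  Apply it to the sums w + u of vectors of the
    unit balls of W and U, and to the image of the unit ball under B.  The
    principle itself comes from Baire's theorem ([closed_cover_ball]) and
    successive approximation.  Only the archimedean property of the norm values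
    is used of the scalar field, so the real and complex cases are treated
    together. *)

(** * Archimedean scalar fields and geometric sequences *)

(** The norm appears because the order of a [numFieldType] is partial: over the
    complex numbers only the real elements can be compared with integers. *)
Definition archimedean_norm (K : numFieldType) : Prop :=
  forall x : K, exists n : nat, `|x| <= n%:R.

Lemma real_or_complex_archimedean (R : realType) (K : numFieldType) :
  real_or_complex R K -> archimedean_norm K.
Proof.
case=> -> x; first by exists (Num.bound `|x|); exact/ltW/archi_boundP.
rewrite normc_def; set r := Num.sqrt _; exists (Num.bound `|r|).
rewrite -(rmorph_nat (real_complex R)) lecR.
exact/(le_trans (ler_norm _))/ltW/archi_boundP.
Qed.

Section Archimedean.
Context {K : numFieldType}.

Lemma pos_lower_bound (a b : K) : 0 < a -> 0 < b ->
  exists c : K, [/\ 0 < c, c <= a & c <= b].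
Proof.
move=> a0 b0; have [ab|/ltW ba] := real_leP (gtr0_real a0) (gtr0_real b0).
  by exists a.
by exists b.
Qed.

Lemma geometric_lt (archiK : archimedean_norm K) (c e : K) : 0 <= c -> 0 < e ->
  exists n : nat, c * 2^-1 ^+ n < e.
Proof.
move=> c0 e0; have [n] := archiK (c / e).
rewrite ger0_norm ?divr_ge0 ?(ltW e0)// ler_pdivrMr// => cn; exists n.
rewrite exprVn ltr_pdivrMr ?exprn_gt0//; apply: le_lt_trans cn _.
by rewrite mulrC ltr_pM2l// -natrX ltr_nat ltn_expl.
Qed.

Section Geometric.
Context (archiK : archimedean_norm K) {V : completeNormedModType K}.

(** Summing the steps gives the bound [2 c 2^-n (1 - 2^-k)], the form in which
    the induction on [k] closes. *)
Lemma geometric_dist (u : nat -> V) (c : K) :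
  (forall n, `|u n.+1 - u n| <= c * 2^-1 ^+ n) ->
  forall n k, `|u (n + k)%N - u n| <= 2 * c * 2^-1 ^+ n.
Proof.
move=> uc n k.
have c0 : 0 <= c by have := uc 0; rewrite expr0 mulr1; exact/le_trans.
suff : `|u (n + k)%N - u n| <= 2 * c * 2^-1 ^+ n * (1 - 2^-1 ^+ k).
  move/le_trans; apply; rewrite ler_piMr//.
    by rewrite !mulr_ge0// exprn_ge0.
elim: k => [|k IH]; first by rewrite addn0 !subrr normr0 mulr0.
rewrite addnS -(subrKA (u (n + k)%N)) (le_trans (ler_normD _ _))//.
rewrite (le_trans (lerD (uc _) IH))// exprS exprD.
by rewrite le_eqVlt; apply/orP; left; apply/eqP; field.
Qed.

Lemma geometric_cvg (u : nat -> V) (c : K) :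
  (forall n, `|u n.+1 - u n| <= c * 2^-1 ^+ n) ->
  exists l : V, u @ \oo --> l.
Proof.
move=> uc; suff : cvg (u @ \oo) by move=> ?; exists (lim (u @ \oo)).
apply: cauchy_cvg; apply/cauchy_exP => e e0.
have c0 : 0 <= c by have := uc 0; rewrite expr0 mulr1; exact/le_trans.
have [n ne] := geometric_lt archiK (2 * c) e (mulr_ge0 (ler0n _ 2) c0) e0.
exists (u n); exists n => //= m /= nm.
rewrite -ball_normE /= distrC; apply: le_lt_trans ne.
by rewrite -(subnKC nm); exact: geometric_dist.
Qed.

End Geometric.

(** * Baire's theorem *)

Section Baire.
Context (archiK : archimedean_norm K) {V : completeNormedModType K}.

Lemma cvg_distP (u : nat -> V) (l : V) : u @ \oo --> l <->
  forall e, 0 < e -> exists N, forall n, (N <= n)%N -> `|l - u n| < e.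
Proof.
split=> [/cvgrPdist_lt ul e e0|ul]; first by have [N _ h] := ul e e0; exists N.
by apply/cvgrPdist_lt => e /ul[N h]; exists N.
Qed.

(** Closed balls are closed; with a partial order on [K], the radius [r] has to
    be compared with [`|a - l|] by hand, which is possible as both are real. *)
Lemma cvg_dist_le (u : nat -> V) (l a : V) (r : K) (N : nat) : 0 <= r ->
  u @ \oo --> l -> (forall n, (N <= n)%N -> `|a - u n| <= r) -> `|a - l| <= r.
Proof.
move=> r0 /cvg_distP ul ur.
have [//|rl] := real_leP (ger0_real (normr_ge0 (a - l))) (ger0_real r0).
have [M uM] := ul (`|a - l| - r) ltac:(by rewrite subr_gt0).
have /uM := leq_maxl M N; have /ur ar := leq_maxr M N.
rewrite le_gtF// lerBlDr.
rewrite -(subrKA (u (maxn M N))) (le_trans (ler_normD _ _))//.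
by rewrite addrC (distrC (u _)) lerD.
Qed.

(** Baire's theorem.  If no [F n] contained a ball, every ball would contain a
    closed ball of at most half its radius that avoids a prescribed [F n]; the
    centres of nested balls avoiding [F 0], [F 1], ... converge to a point that
    lies in no [F n]. *)
Lemma closed_cover_ball (F : nat -> set V) :
  (forall n, closed (F n)) -> (forall x, exists n, F n x) ->
  exists n x e, 0 < e /\ forall y, `|x - y| < e -> F n y.
Proof.
move=> Fcl Fcov; apply: contrapT => noball.
(* A pair (x, e) stands for the closed ball of centre x and radius e; the
   hypothesis 0 < e is kept inside the existential so that [choice] applies. *)
have step (np : nat * (V * K)) : exists q : V * K, 0 < np.2.2 ->
    [/\ 0 < q.2, q.2 <= np.2.2 * 2^-1 & forall z, `|q.1 - z| <= q.2 ->
        `|np.2.1 - z| <= np.2.2 /\ ~ F np.1 z].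
  case: np => n [x e] /=.
  have [e0|e0] := pselect (0 < e); last by exists (x, e).
  have [y [xy nFy]] : exists y, `|x - y| < e /\ ~ F n y.
    apply: contrapT => h; apply: noball; exists n, x, e; split=> // y xy.
    by apply: contrapT => nFy; apply: h; exists y.
  have /open_nbhs_nbhs/nbhs_ballP[d /= d0 yd] : open_nbhs y (~` F n).
    by split=> //; apply: closed_openC.
  have xy0 : 0 < e - `|x - y| by rewrite subr_gt0.
  have [c [c0 cd cxy]] := pos_lower_bound _ _ d0 xy0.
  have [c' [c'0 c'c c'e]] := pos_lower_bound _ _ c0 e0.
  have h2 : 0 < 2 :> K by [].
  exists (y, c' / 2) => _; split => /= [||z yz].
  - by rewrite divr_gt0.
  - by rewrite ler_pM2r// invr_gt0.
  have yzc : `|y - z| < c.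
    apply: le_lt_trans yz _; apply: lt_le_trans c'c.
    by rewrite ltr_pdivrMr// ltr_pMr// ltr1n.
  split; last by apply: yd; rewrite -ball_normE /=; exact: lt_le_trans cd.
  rewrite -(subrKA y) (le_trans (ler_normD _ _))// -lerBrDl.
  by apply: le_trans cxy; exact: ltW.
have [g gP] := choice step.
pose fix u n : V * K := if n is m.+1 then g (m, u m) else (0, 1).
have u0 n : 0 < (u n).2 by elim: n => //= n IH; have [] := gP (n, u n) IH.
have uS n := gP (n, u n) (u0 n).
have u2 n : (u n).2 <= 2^-1 ^+ n.
  elim: n => [//|n IH]; have [_ le _] := uS n.
  by apply: le_trans le _; rewrite exprSr ler_wpM2r.
have nest k n z : `|(u (n + k)%N).1 - z| <= (u (n + k)%N).2 ->
    `|(u n).1 - z| <= (u n).2.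
  elim: k => [|k IH]; first by rewrite addn0.
  by rewrite addnS => h; have [_ _ /(_ z h)[/IH]] := uS (n + k)%N.
have unm n m : (n <= m)%N -> `|(u n).1 - (u m).1| <= (u n).2.
  move=> nm; apply: (nest (m - n)%N); rewrite subnKC// subrr normr0.
  exact: ltW.
have [|l ul] := geometric_cvg archiK (fun n => (u n).1) 1.
  by move=> n; rewrite mul1r distrC; apply: le_trans (u2 n); exact: unm.
have unl n : `|(u n).1 - l| <= (u n).2.
  apply: (cvg_dist_le _ _ _ _ n _ ul (unm n)); exact: ltW.
have [n Fnl] := Fcov l.
by have [_ _ /(_ l (unl n.+1))[]] := uS n.
Qed.

End Baire.
End Archimedean.

(** * Superconvex absorbing sets *)

Section Superconvex.
Context {K : numFieldType} (archiK : archimedean_norm K).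
Context {V : completeNormedModType K}.

(** Stability under the convex combinations of weights 1/2, 1/4, 1/8, ...: a form
    of CS-closedness that holds for many sets which need not be closed, such as
    the image of the closed unit ball of a Banach space under a bounded
    operator. *)
Definition superconvex (B : set V) : Prop :=
  forall b : nat -> V, (forall n, B (b n)) ->
  forall y, series (fun n => 2^-1 ^+ n.+1 *: b n) @ \oo --> y -> B y.

(** The closures of the sets [(n+1) B] cover [V], so one of them contains a ball
    (Baire); centring it at 0 by symmetry, [B] is dense in a ball of radius [d].
    A vector [y] of norm less than [d/2] is then expanded greedily: approximate
    [2 y] by a point of [B] up to [d/2], double the error, and repeat.  This
    writes [y] as a combination of points of [B] with weights 1/2, 1/4, ... *)
Lemma superconvex_absorbing_ball (B : set V) :
  superconvex B ->
  (forall y z, B y -> B z -> B (2^-1 *: (y - z))) ->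
  (forall y, exists n : nat, B (n.+1%:R^-1 *: y)) ->
  exists d, 0 < d /\ forall y, `|y| < d -> B y.
Proof.
move=> Bsup Bmid Babs.
have n0 n : 0 < n.+1%:R :> K by rewrite ltr0n.
pose F n := closure [set y | B (n.+1%:R^-1 *: y)].
have [||n [x [e [e0 xF]]]] := closed_cover_ball archiK F.
- by move=> n; exact: closed_closure.
- by move=> y; have [n Bn] := Babs y; exists n; exact: subset_closure.
have dense_ball z r : `|z| < e / n.+1%:R -> 0 < r ->
    exists b, B b /\ `|z - b| < r.
  move=> ze r0; pose z' : V := n.+1%:R *: z.
  have z'e : `|z'| < e.
    by rewrite normrZ gtr0_norm// mulrC -ltr_pdivlMr.
  have approx y : `|x - y| < e -> exists b, B b /\ `|n.+1%:R^-1 *: y - b| < r.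
    move=> /xF /(_ (ball y (r * n.+1%:R))) [].
      by apply: nbhsx_ballx; rewrite mulr_gt0.
    move=> y' [By']; rewrite -ball_normE /= => yy'; exists (n.+1%:R^-1 *: y').
    split=> //; rewrite -scalerBr normrZ gtr0_norm ?invr_gt0//.
    by rewrite mulrC ltr_pdivrMr.
  (* x + z' and x - z' lie in the ball centred at x, and z is half of their
     difference divided by n + 1. *)
  have [|b [Bb xb]] := approx (x + z'); first by rewrite opprD addNKr normrN.
  have [|c [Bc xc]] := approx (x - z'); first by rewrite opprB addrC subrK.
  exists (2^-1 *: (b - c)); split; first exact: Bmid.
  have -> : z = 2^-1 *: (n.+1%:R^-1 *: (x + z') - n.+1%:R^-1 *: (x - z')).
    rewrite -scalerBr opprB [x + z' + _]addrC addrA subrK.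
    have -> : z' + z' = 2 *: z' by rewrite scaler_nat mulr2n.
    have n1 : 2^-1 * n.+1%:R^-1 * (2 * n.+1%:R) = 1 :> K.
      by rewrite mulrACA !mulVf ?mulr1 ?pnatr_eq0.
    by rewrite /z' !scalerA n1 scale1r.
  rewrite -scalerBr opprB.
  set p := _ *: _ in xb *; set q := _ *: _ in xc *.
  rewrite normrZ ger0_norm ?invr_ge0// mulrC ltr_pdivrMr// mulr_natr mulr2n.
  rewrite (_ : p - q + (c - b) = (p - b) - (q - c)).
    by apply: le_lt_trans (ler_normB _ _) _; apply: ltrD.
  by rewrite opprB addrACA [X in _ + X]addrC addrACA.
pose d := e / n.+1%:R.
have d0 : 0 < d by rewrite divr_gt0.
have h2 : 0 < 2 :> K by [].
have step r : exists b, `|r| < d -> B b /\ `|2 *: (r - b)| < d.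
  have [rd|rd] := pselect (`|r| < d); last by exists 0.
  have [|b [Bb rb]] := dense_ball r (d / 2) rd; first by rewrite divr_gt0.
  by exists b => _; split=> //; rewrite normrZ normr_nat mulrC -ltr_pdivlMr.
have [g gP] := choice step.
exists (d / 2); split=> [|y yd]; first by rewrite divr_gt0.
pose r n := iter n (fun r => 2 *: (r - g r)) (2 *: y).
have rd k : `|r k| < d.
  elim: k => [|k IH]; last by have [] := gP _ IH.
  by rewrite normrZ normr_nat mulrC -ltr_pdivlMr.
have yE k :
    y = series (fun n => 2^-1 ^+ n.+1 *: g (r n)) k + 2^-1 ^+ k.+1 *: r k.
  elim: k => [|k IH].
    by rewrite seriesEnat /= big_geq// add0r scalerA mulVf ?scale1r// gt_eqF.
  rewrite seriesSr -addrA [LHS]IH; congr (_ + _).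
  rewrite /= scalerA [2^-1 ^+ k.+2]exprSr mulfVK ?gt_eqF//.
  by rewrite scalerBr addrC subrK.
apply: (Bsup (fun n => g (r n))) => [k|]; first by have [] := gP _ (rd k).
apply/cvg_distP => eps eps0.
have [N NP] := geometric_lt archiK d eps (ltW d0) eps0.
exists N => k Nk; rewrite {1}(yE k) addrC addKr.
rewrite normrZ ger0_norm ?exprn_ge0//; apply: le_lt_trans NP.
rewrite mulrC ler_pM// ?exprn_ge0//; first exact: ltW.
by rewrite ler_wiXn2l ?invr_ge0 ?invf_le1 ?ler1n// ltnW.
Qed.


(** The same fact for all vectors at once: the gauge of [B] is at most
    [M * `|y|].  This form needs no case analysis on [y = 0]. *)
Lemma superconvex_absorbing_gauge (B : set V) :
  superconvex B ->
  (forall y z, B y -> B z -> B (2^-1 *: (y - z))) ->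
  (forall y, exists n : nat, B (n.+1%:R^-1 *: y)) ->
  exists M, 0 <= M /\ forall y, exists2 z, B z & y = (M * `|y|) *: z.
Proof.
move=> Bsup Bmid Babs.
have [d [d0 dB]] := superconvex_absorbing_ball _ Bsup Bmid Babs.
exists (2 / d); split=> [|y]; first by rewrite divr_ge0// ltW.
have [->|y0] := eqVneq y 0.
  have [n] := Babs 0; rewrite scaler0 => B0.
  by exists 0 => //; rewrite scaler0.
have yp : 0 < `|y| by rewrite normr_gt0.
have c0 : 0 < 2 / d * `|y| by rewrite mulr_gt0// divr_gt0.
exists ((2 / d * `|y|)^-1 *: y);
  last by rewrite scalerA divff ?scale1r// gt_eqF.
apply: dB; rewrite normrZ gtr0_norm ?invr_gt0// mulrC ltr_pdivrMr//.
by rewrite mulrA mulrCA divff ?gt_eqF// mulr1 ltr_pMl// ltr1n.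
Qed.

End Superconvex.

(** * Direct sums of closed subspaces *)

Section ClosedSubspaces.
Context {K : numFieldType} (archiK : archimedean_norm K).
Context {V : completeNormedModType K}.

Lemma closed_subspace0 (D : set V) : closed_subspace D -> D 0.
Proof. by case=> _ [/set_mem]. Qed.

Lemma closed_subspaceP (D : set V) : closed_subspace D ->
  forall (a : K) u v, D u -> D v -> D (a *: u + v).
Proof.
case=> _ [_ Dlin] a u v Du Dv.
by apply: set_mem; apply: Dlin; apply: mem_set.
Qed.

Lemma closed_subspaceZ (D : set V) : closed_subspace D ->
  forall (a : K) u, D u -> D (a *: u).
Proof.
move=> Dsub a u Du; rewrite -[_ *: _]addr0; apply: closed_subspaceP => //.
exact: closed_subspace0.
Qed.

Lemma closed_subspaceB (D : set V) : closed_subspace D ->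
  forall u v, D u -> D v -> D (u - v).
Proof.
by move=> Dsub u v Du Dv; rewrite addrC -scaleN1r; exact: closed_subspaceP.
Qed.

(** The source of superconvexity: the series converges by completeness, its
    partial sums have norm at most [1 - 2^-n], and the limit stays in the closed
    subspace. *)
Lemma unit_ball_series (D : set V) (x : nat -> V) : closed_subspace D ->
  (forall n, D (x n)) -> (forall n, `|x n| <= 1) ->
  exists l, [/\ D l, `|l| <= 1 &
    series (fun n => 2^-1 ^+ n.+1 *: x n) @ \oo --> l].
Proof.
move=> Dsub Dx x1; set s := series _.
have s0 : s 0%N = 0 by rewrite /s seriesEnat /= big_geq.
have h0 n : 0 <= 2^-1 ^+ n :> K by rewrite exprn_ge0// invr_ge0.
have xS n : `|2^-1 ^+ n.+1 *: x n| <= 2^-1 ^+ n.+1.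
  by rewrite normrZ ger0_norm// ler_piMr.
have [|l sl] := geometric_cvg archiK s 1.
  move=> n; rewrite /s seriesSr addrAC subrr add0r mul1r.
  by apply: le_trans (xS n) _; rewrite exprS ler_piMl// invf_le1// ler1n.
have sle n : `|s n| <= 1 - 2^-1 ^+ n.
  elim: n => [|n IH]; first by rewrite s0 normr0 subrr.
  rewrite /s seriesSr (le_trans (ler_normD _ _))//.
  rewrite (le_trans (lerD IH (xS n)))// le_eqVlt; apply/orP; left; apply/eqP.
  by rewrite exprS; field.
exists l; split=> //.
- case: (Dsub) => Dcl _; apply: (closed_cvg D Dcl _ _ sl).
  apply: nearW => n; elim: n => [|n IH].
    by rewrite s0; exact: closed_subspace0.
  by rewrite /s seriesSr addrC; exact: closed_subspaceP.
- rewrite -normrN -sub0r; apply: (cvg_dist_le _ _ _ _ 0%N _ sl) => // n _.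
  by rewrite sub0r normrN (le_trans (sle n))// gerBl.
Qed.

Lemma direct_sum_inj (W U : set V) :
  closed_subspace W -> closed_subspace U -> W `&` U = [set 0] ->
  forall w w' u u', W w -> W w' -> U u -> U u' -> w + u = w' + u' ->
  w = w' /\ u = u'.
Proof.
move=> Ws Us WU w w' u u' Ww Ww' Uu Uu' e.
have e' : w - w' = u' - u.
  by apply/eqP; rewrite subr_eq addrAC [u' + w']addrC -e addrK.
have /eqP : w - w' = 0.
  suff : (W `&` U) (w - w') by rewrite WU.
  by split; [|rewrite e']; exact: closed_subspaceB.
rewrite subr_eq0 => /eqP ww'; split=> //.
by move: e; rewrite ww' => /addrI.
Qed.

Lemma unit_ball_half_sub (y z : V) :
  `|y| <= 1 -> `|z| <= 1 -> `|2^-1 *: (y - z)| <= 1.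
Proof.
move=> y1 z1; rewrite normrZ ger0_norm ?invr_ge0// mulrC ler_pdivrMr// mul1r.
by rewrite (le_trans (ler_normB _ _))// -[2]/(1 + 1) lerD.
Qed.

Lemma unit_ball_absorbing (y : V) (n : nat) :
  `|y| <= n%:R -> `|n.+1%:R^-1 *: y| <= 1.
Proof.
move=> yn; rewrite normrZ ger0_norm ?invr_ge0// mulrC ler_pdivrMr ?ltr0n//.
by rewrite mul1r (le_trans yn)// ler_nat.
Qed.

(** An algebraic direct sum of closed subspaces is topological: the sums of
    vectors of the two unit balls form a superconvex set, since the series of
    both components converge; being absorbing, this set contains a ball. *)
Lemma direct_sum_bounded (W U : set V) :
  closed_subspace W -> closed_subspace U -> direct_sum W U ->
  exists M, 0 <= M /\ forall w u, W w -> U u ->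
    `|w| <= M * `|w + u| /\ `|u| <= M * `|w + u|.
Proof.
move=> Ws Us [WU0 WUT].
pose B : set V := [set x | exists w u,
  [/\ W w, U u, `|w| <= 1, `|u| <= 1 & x = w + u]].
have [|||M [M0 MB]] := superconvex_absorbing_gauge archiK B.
- move=> b Bb y sy.
  have /choice[w /choice[u wuP]] := Bb.
  have [||l [Wl l1 wl]] := unit_ball_series W w Ws;
    try by move=> n; case: (wuP n).
  have [||m [Um m1 um]] := unit_ball_series U u Us;
    try by move=> n; case: (wuP n).
  exists l, m; split=> //; apply: (cvg_unique (@norm_hausdorff _ _) sy).
  rewrite (_ : series _ = series (fun n => 2^-1 ^+ n.+1 *: w n) \+
                          series (fun n => 2^-1 ^+ n.+1 *: u n)).
    exact: cvgD.
  apply/funext => n; rewrite /series /= -big_split /=.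
  by apply: eq_bigr => i _; rewrite -scalerDr; case: (wuP i) => _ _ _ _ ->.
- move=> _ _ [w [u [Ww Uu w1 u1 ->]]] [w' [u' [Ww' Uu' w'1 u'1 ->]]].
  exists (2^-1 *: (w - w')), (2^-1 *: (u - u')); split.
  + by apply: closed_subspaceZ => //; exact: closed_subspaceB.
  + by apply: closed_subspaceZ => //; exact: closed_subspaceB.
  + exact: unit_ball_half_sub.
  + exact: unit_ball_half_sub.
  + by rewrite -scalerDr opprD addrACA.
- move=> y; have : subspace_sum W U y by rewrite WUT.
  move=> [w Ww [u Uu <-]].
  have [n] := archiK (`|w| + `|u|); rewrite ger0_norm ?addr_ge0// => wun.
  exists n, (n.+1%:R^-1 *: w), (n.+1%:R^-1 *: u); split.
  + exact: closed_subspaceZ.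
  + exact: closed_subspaceZ.
  + by apply: unit_ball_absorbing; apply: le_trans wun; rewrite lerDl.
  + by apply: unit_ball_absorbing; apply: le_trans wun; rewrite lerDr.
  + by rewrite scalerDr.
exists M; split=> // w u Ww Uu.
have [_ [w' [u' [Ww' Uu' w'1 u'1 ->]]]] := MB (w + u).
set c := M * _; have c0 : 0 <= c by rewrite mulr_ge0.
rewrite scalerDr => /(direct_sum_inj _ _ Ws Us WU0)[||||-> ->] //;
  try exact: closed_subspaceZ.
by split; rewrite normrZ (ger0_norm c0) ler_piMr.
Qed.

End ClosedSubspaces.

(** * The open mapping theorem and null spaces *)

Section Operators.
Context {K : numFieldType} (archiK : archimedean_norm K).

(** Over a partially ordered [K] the bound [M] may fail to be a nonnegative real
    when [D] is contained in [[set 0]]; its norm always works. *)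
Lemma op_bounded_on_ge0 (E F : normedModType K) (D : set E) (f : E -> F) :
  op_bounded_on D f -> exists M, 0 <= M /\ forall x, D x -> `|f x| <= M * `|x|.
Proof.
move=> [M fM]; exists `|M|; split=> // x Dx.
have Mx := fM x Dx; apply: (le_trans Mx).
have M0 : 0 <= M * `|x| by apply: le_trans Mx.
by rewrite -(ger0_norm M0) normrM normr_id.
Qed.

Lemma op_bounded_cvg (E F : completeNormedModType K) (f : {linear E -> F})
    (u : nat -> E) (l : E) :
  op_bounded f -> u @ \oo --> l -> (fun n => f (u n)) @ \oo --> f l.
Proof.
move=> /op_bounded_on_ge0[M [M0 fM]] /cvg_distP ul.
apply/cvg_distP => e e0.
have M1 : 0 < M + 1 by rewrite ltr_wpDl.
have [N uN] := ul (e / (M + 1)) ltac:(by rewrite divr_gt0).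
exists N => n /uN; rewrite ltr_pdivlMr// mulrC => uMe.
rewrite -linearB; apply: le_lt_trans uMe.
by rewrite (le_trans (fM _ I))// ler_wpM2r// lerDl.
Qed.

Lemma closed_subspaceT (E : completeNormedModType K) :
  closed_subspace [set: E].
Proof.
split; first exact: closedT.
by split=> [|a u v _ _]; apply: mem_set.
Qed.

(** The image of the unit ball under a bounded surjection is superconvex, because
    a series in the image lifts to a convergent series in the ball, and it is
    absorbing by surjectivity. *)
Lemma open_mapping (E F : completeNormedModType K) (f : {linear E -> F}) :
  op_bounded f -> set_surj setT setT f ->
  exists M, 0 <= M /\ forall y, exists2 x, f x = y & `|x| <= M * `|y|.
Proof.
move=> fbd fsurj.
have [|||M [M0 MB]] :=
    superconvex_absorbing_gauge archiK (f @` [set x | `|x| <= 1]).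
- move=> b Bb y sy.
  have /choice[x xP] n : exists x, `|x| <= 1 /\ f x = b n.
    by have [x] := Bb n; exists x.
  have [||l [_ l1 xl]] :=
      unit_ball_series archiK setT x (closed_subspaceT E);
    try by move=> n; case: (xP n).
  exists l => //.
  have := op_bounded_cvg _ _ _ _ _ fbd xl.
  rewrite (_ : (fun n => _) = series (fun n => 2^-1 ^+ n.+1 *: b n)).
    by move=> fl; apply: (cvg_unique (@norm_hausdorff _ _) fl sy).
  apply/funext => n; rewrite /series /= linear_sum.
  by apply: eq_bigr => i _; rewrite linearZ /=; case: (xP i) => _ ->.
- move=> _ _ [x x1 <-] [x' x'1 <-]; exists (2^-1 *: (x - x')).
    exact: unit_ball_half_sub.
  by rewrite linearZ linearB.
- move=> y; have [x _ <-] := fsurj y I.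
  have [n xn] := archiK `|x|.
  exists n, (n.+1%:R^-1 *: x); last by rewrite linearZ.
  by apply: unit_ball_absorbing; rewrite -normr_id.
exists M; split=> // y; have [_ [x x1 <-] yE] := MB y.
exists ((M * `|y|) *: x); first by rewrite linearZ /= -yE.
have c0 : 0 <= M * `|y| by rewrite mulr_ge0.
by rewrite normrZ (ger0_norm c0) ler_piMr.
Qed.

Lemma null_space_closed_subspace (E F : completeNormedModType K)
    (f : {linear E -> F}) : op_bounded f -> closed_subspace (null_space f).
Proof.
move=> fbd; split; last first.
  split=> [|a u v /set_mem fu /set_mem fv]; apply: mem_set.
    by rewrite /null_space /= linear0.
  by rewrite /null_space /= linearP fu fv scaler0 addr0.
have [M [M0 fM]] := op_bounded_on_ge0 _ _ _ _ fbd.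
move=> x xN; apply: contrapT => /eqP fx0.
have fxp : 0 < `|f x| by rewrite normr_gt0.
have M1 : 0 < M + 1 by rewrite ltr_wpDl.
have [|y [/= fy]] := xN (ball x (`|f x| / (M + 1))).
  by apply: nbhsx_ballx; rewrite divr_gt0.
rewrite -ball_normE /= ltr_pdivlMr// mulrC => xy.
suff : `|f x| < `|f x| by rewrite ltxx.
apply: le_lt_trans xy; rewrite -{1}[f x]subr0 -fy -linearB.
by rewrite (le_trans (fM _ I))// ler_wpM2r// lerDl.
Qed.

(** Openness of [f] turns density of [f @` U] into density of [U + N(f)]: the
    defect [f u - f x] lifts to a small vector [z], and then
    [x + z = u + (x + z - u)] with [x + z - u] in [N(f)]. *)
Lemma quasi_complement_null_space (E F : completeNormedModType K)
    (f : {linear E -> F}) (U : set E) :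
  op_bounded f -> set_surj setT setT f -> closed_subspace U ->
  (forall u, U u -> f u = 0 -> u = 0) -> dense (f @` U) ->
  quasi_complement (null_space f) U.
Proof.
move=> fbd fsurj Us finj fdense; split=> //.
- exact: null_space_closed_subspace.
- apply/seteqP; split=> [u [Uu fu]|_ ->]; first exact: finj.
  by split; [exact: closed_subspace0|rewrite /null_space /= linear0].
move=> O [x Ox] Oopen.
have /nbhs_ballP[e /= e0 xe] : nbhs x O by exact: open_nbhs_nbhs.
have [M [M0 fM]] := open_mapping _ _ _ fbd fsurj.
have M1 : 0 < M + 1 by rewrite ltr_wpDl.
have d0 : 0 < e / (M + 1) by rewrite divr_gt0.
have [||y [/= xd [u Uu fu]]] := fdense (ball (f x) (e / (M + 1))).
- by exists (f x); exact: ballxx.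
- exact: ball_open.
rewrite -fu in xd; have [z fz zM] := fM (f u - f x).
exists (x + z); split.
  apply: xe; rewrite -ball_normE /= opprD addNKr normrN.
  apply: le_lt_trans zM _.
  move: xd; rewrite -ball_normE /= distrC ltr_pdivlMr// mulrC.
  by apply: le_lt_trans; rewrite ler_wpM2r// lerDl.
exists u => //; exists (x + z - u); last by rewrite addrC subrK.
by rewrite /null_space /= linearB linearD fz [f x + _]addrC subrK subrr.
Qed.

End Operators.

(** * The surjective extension *)

Theorem theorem8 (R : realType) (K : numFieldType)
    (hK : real_or_complex R K)
    (X Y Xt : completeNormedModType K)
    (A : {linear X -> Y}) (A_bounded : op_bounded A)
    (A_inj : injective A) (A_dense : dense (range A))
    (W U : set Xt)
    (W_closed : closed_subspace W) (U_closed : closed_subspace U)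
    (WU_direct : direct_sum W U)
    (C : Xt -> Y) (C_linear : linear_on W C) (C_bounded : op_bounded_on W C)
    (C_surj : set_surj W setT C)
    (T : {linear X -> Xt}) (T_iso : isomorphism_onto U T) :
  exists B : {linear Xt -> Y},
    [/\ op_bounded B,
        set_surj setT setT B,
        forall x : X, A x = B (T x) &
        quasi_complement (null_space B) U].
Proof.
have archiK := real_or_complex_archimedean _ _ hK.
have [_ [TU _ Tsurj] [S [TS S_bounded]]] := T_iso.
have UT a : U (T a) by apply: TU.
have C0 : C 0 = 0.
  have W0 := closed_subspace0 _ W_closed.
  have := C_linear (-1) 0 0 W0 W0.
  by rewrite scaleN1r oppr0 addr0 scaleN1r addNr.
have /choice[w /choice[a waP]] (x : Xt) : exists v b, W v /\ x = v + T b.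
  have : subspace_sum W U x by rewrite WU_direct.2.
  by move=> [v Wv [u /Tsurj[b _ <-] <-]]; exists v, b.
have Ww x : W (w x) by case: (waP x).
have decomp x : x = w x + T (a x) by case: (waP x).
have uniq x v b : W v -> x = v + T b -> w x = v /\ a x = b.
  move=> Wv; rewrite {1}(decomp x).
  move=> /(direct_sum_inj _ _ W_closed U_closed WU_direct.1)[] // ->.
  by move=> /(can_inj TS) ->.
pose B0 x := C (w x) + A (a x).
have B0_linear : linear B0.
  move=> k x y; have [] := uniq (k *: x + y) (k *: w x + w y) (k *: a x + a y).
  - exact: closed_subspaceP.
  - by rewrite linearP addrACA -scalerDr -!decomp.
  rewrite /B0 => -> ->; rewrite C_linear// linearP.
  by rewrite addrACA -scalerDr.
pose B : {linear Xt -> Y} :=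
  HB.pack B0 (GRing.isLinear.Build _ _ _ _ B0 B0_linear).
have BW v : W v -> B v = C v.
  move=> Wv; have [||eqw eqa] := uniq v v 0 => //.
    by rewrite linear0 addr0.
  by rewrite /= /B0 eqw eqa linear0 addr0.
have BT b : B (T b) = A b.
  have [||eqw eqa] := uniq (T b) 0 b; first exact: closed_subspace0.
    by rewrite add0r.
  by rewrite /= /B0 eqw eqa C0 add0r.
have B_bounded : op_bounded B.
  have [M [M0 WUM]] :=
    direct_sum_bounded archiK _ _ W_closed U_closed WU_direct.
  have [MC [MC0 CM]] := op_bounded_on_ge0 _ _ _ _ C_bounded.
  have [MA [MA0 AM]] := op_bounded_on_ge0 _ _ _ _ A_bounded.
  have [MS [MS0 SM]] := op_bounded_on_ge0 _ _ _ _ S_bounded.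
  exists (MC * M + MA * (MS * M)) => x _.
  have [wM uM] := WUM _ _ (Ww x) (UT (a x)); rewrite -decomp in wM uM.
  rewrite mulrDl (le_trans (ler_normD _ _))// lerD//.
    by rewrite (le_trans (CM _ (Ww x)))// -mulrA ler_wpM2l.
  rewrite (le_trans (AM _ I))// -!mulrA ler_wpM2l//.
  by rewrite -[a x]TS (le_trans (SM _ (UT (a x))))// ler_wpM2l.
have B_surj : set_surj setT setT B.
  by move=> y /C_surj[v Wv <-]; exists v => //; exact: BW.
exists B; split=> //; apply: quasi_complement_null_space => //.
- move=> u /Tsurj[b _ <-]; rewrite BT => Ab0.
  by rewrite (A_inj b 0) ?linear0.
- rewrite (_ : B @` U = range A)//; apply/seteqP; split.
    by move=> _ [u /Tsurj[b _ <-] <-]; rewrite BT; exists b.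
  by move=> _ [b _ <-]; exists (T b).
Qed.
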